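(* Suppose that the topological Abelian groups $G,H$ are connected and are Baire spaces, and either (i) at least one of $G$ and $H$ is metrizable, or (ii) $G$ and $H$ are locally compact. If $f\colon G\times H\to\mathbb{C}$ is a separately generalized polynomial function, then $f$ is a generalized polynomial on $G\times H$.
   Context: Groups are written additively. For a topological Abelian group $G$, a function $f\colon G\to\mathbb{C}$ and $h\in G$, put $\Delta_h f(x)=f(x+h)-f(x)$. A continuous function $f\colon G\to\mathbb{C}$ is a generalized polynomial if there is an integer $n\ge 0$ such that $\Delta_{h_1}\cdots\Delta_{h_{n+1}}f=0$ for every $h_1,\ldots,h_{n+1}\in G$. The set of generalized polynomials on $G$ is denoted by $\mathcal{GP}_G$. The product $G\times H$ carries the product topology and the coordinatewise group operation. For $f\colon G\times H\to\mathbb{C}$, the sections are $f_x\colon H\to\mathbb{C}$ and $f^y\colon G\to\mathbb{C}$, $f_x(y)=f^y(x)=f(x,y)$. The function $f$ is a separately generalized polynomial function if $f_x\in\mathcal{GP}_H$ for every $x\in G$ and $f^y\in\mathcal{GP}_G$ for every $y\in H$. *)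

(* Defs.v *)
From HB Require Import structures.
From mathcomp Require Import all_boot all_order all_algebra.
From mathcomp Require Import all_classical all_reals.
From mathcomp Require Import topology normedtype.
From mathcomp Require Import complex.

Set Implicit Arguments.
Unset Strict Implicit.
Unset Printing Implicit Defensive.

Import Order.TTheory GRing.Theory Num.Theory.
Import numFieldTopology.Exports.

Local Open Scope classical_set_scope.
Local Open Scope ring_scope.

(* The instance cannot be inferred on G * H: the library reserves this key for
   products of topological vector spaces. The group prodG below packs the
   topology and the addition that the library puts on any product. *)
Section ProductTopologicalZmodule.
Variables G H : topologicalZmodType.

Lemma prod_sub_continuous :
  continuous (fun z : (G * H) * (G * H) => z.1 - z.2).
Proof.
have diff_cont (M : topologicalZmodType) (u v : (G * H) * (G * H) -> M) :
    continuous u -> continuous v -> continuous (fun z => u z - v z).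
  move=> cu cv z.
  apply: (@continuous_comp _ _ _ (fun z => (u z, v z)) (fun p => p.1 - p.2)).
    exact: cvg_pair (cu z) (cv z).
  exact: sub_continuous.
have comp_cont (X Y Z : topologicalType) (u : X -> Y) (v : Y -> Z) :
    continuous u -> continuous v -> continuous (fun z => v (u z)).
  by move=> cu cv z; apply: continuous_comp; [exact: cu|exact: cv].
have c1 (X Y : topologicalType) : continuous (fun z : X * Y => z.1).
  by move=> z; exact: cvg_fst.
have c2 (X Y : topologicalType) : continuous (fun z : X * Y => z.2).
  by move=> z; exact: cvg_snd.
have coord_cont (M : topologicalZmodType) (k : G * H -> M) : continuous k ->
    continuous (fun z : (G * H) * (G * H) => k z.1 - k z.2).
  move=> ck; apply: diff_cont.
    exact: (comp_cont _ _ _ _ _ (c1 _ _) ck).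
  exact: (comp_cont _ _ _ _ _ (c2 _ _) ck).
move=> z; exact: cvg_pair (coord_cont _ _ (c1 G H) z)
                          (coord_cont _ _ (c2 G H) z).
Qed.

Definition prodG : topologicalZmodType :=
  HB.pack (G * H)%type
    (PreTopologicalNmodule_isTopologicalZmodule.Build (G * H)%type
       prod_sub_continuous).

End ProductTopologicalZmodule.

Section Spaces.
Variable T : topologicalType.

Definition baire_space := forall F : nat -> set T,
  (forall i, open (F i) /\ dense (F i)) -> dense (\bigcap_i F i).

Definition metrizable (R : realType) := exists d : T -> T -> R,
  [/\ forall x y, 0 <= d x y,
      forall x y, d x y = 0 <-> x = y,
      forall x y, d x y = d y x,
      forall x y z, d x z <= d x y + d y z &
      forall x, nbhs x = nbhs_ball_ (fun u e => [set v | d u v < e]) x].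

End Spaces.

Section GeneralizedPolynomials.
Variable R : realType.

Definition Delta (G : topologicalZmodType) (h : G) (f : G -> R[i]) : G -> R[i] :=
  fun x => f (x + h) - f x.

(* R[i]^o is R[i] with the topology of its modulus.
   On [:: h_1; ...; h_(n+1)], the fold is Delta h_1 (... (Delta h_(n+1) f)). *)
Definition gen_poly (G : topologicalZmodType) (f : G -> R[i]) :=
  continuous (f : G -> R[i]^o) /\
  exists n : nat, forall hs : n.+1.-tuple G, foldr (@Delta G) f hs = cst 0.

Definition separately_gen_poly (G H : topologicalZmodType)
    (f : G * H -> R[i]) :=
  (forall x : G, gen_poly (fun y : H => f (x, y))) /\
  (forall y : H, gen_poly (fun x : G => f (x, y))).

End GeneralizedPolynomials.

(* Main.v *)
Require Import Defs.
From mathcomp Require Import all_boot all_order all_algebra.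
From mathcomp Require Import all_classical all_reals.
From mathcomp Require Import topology normedtype.
From mathcomp Require Import complex.
From mathcomp Require Import ring.
Import Order.TTheory GRing.Theory Num.Theory.
Import numFieldTopology.Exports.
Local Open Scope classical_set_scope.
Local Open Scope ring_scope.

(** A generalized polynomial on a product is controlled in two independent
    respects: its degree, and its continuity. Both come from the Baire category
    theorem followed by the rigidity of polynomials on connected groups.

    Degree. For fixed [n] the points [x] where the section [f_x] has degree at
    most [n] form a closed set, because each iterated difference of [f_x] at [y]
    is a finite sum of values of continuous sections [f^y]. These sets cover
    [G], so one of them contains an open set. As a function of [x], an iterated
    difference of [f_x] at [y] is again a polynomial, and a polynomial that
    vanishes on a nonempty open set of a connected group vanishes identically
    ([deg_lt_vanish]). Hence all the [f_x] have a common degree bound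
    ([section_deg_bounded]), likewise all the [f^y], and a difference step in
    the product splits into one step in each factor, so that the bounds add up
    ([deg_lt_prod]).

    Continuity. A polynomial of degree at most [n] that is bounded on one
    nonempty open set is continuous everywhere ([deg_lt_continuous]). Thus it
    suffices to bound [f] on an open box, and a second Baire argument does it
    ([bounded_on_box]) as soon as one factor has a sequence of neighbourhoods
    [K_N] of [0] such that every continuous function is bounded by [N] on some
    [K_N]: balls of radius [1 / (N + 1)] when the factor is metrizable, a fixed
    compact neighbourhood when it is locally compact.

    The heart of the matter is [deg_lt_equicontinuous], by induction on the
    degree: over a long arithmetic progression [x, x + v, ..., x + k v] that
    stays close to [x], the increments of [f] are almost equal, by induction
    applied to [Delta v f], while their sum is bounded; so each increment is
    small. *)

Set Implicit Arguments.
Unset Strict Implicit.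
Unset Printing Implicit Defensive.

(** * Topological groups and Baire spaces *)

Section TopologicalGroups.
Variable G : topologicalZmodType.
Implicit Types (x y h : G) (S U V W : set G).

Lemma continuous_addr h : continuous (fun x : G => x + h).
Proof.
move=> x; apply: (@continuous_comp _ _ _ (fun x => (x, h)) (fun p => p.1 + p.2)).
  by apply: cvg_pair; [exact: cvg_id|exact: cvg_cst].
exact: add_continuous.
Qed.

Lemma continuous_rsub y : continuous (fun x : G => y - x).
Proof.
move=> x; apply: (@continuous_comp _ _ _ (fun x => (y, x)) (fun p => p.1 - p.2)).
  by apply: cvg_pair; [exact: cvg_cst|exact: cvg_id].
exact: sub_continuous.
Qed.

Lemma continuous_mulrn k : continuous (fun x : G => x *+ k).
Proof.
elim: k => [|k IHk] x.
  by rewrite (_ : (fun x : G => x *+ 0) = cst 0)//; exact: cvg_cst.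
rewrite (_ : (fun x : G => x *+ k.+1) = (fun x => x + x *+ k)); last first.
  by apply/funext => z; rewrite mulrS.
apply: (@continuous_comp _ _ _ (fun x => (x, x *+ k)) (fun p => p.1 + p.2)).
  by apply: cvg_pair; [exact: cvg_id|exact: IHk].
exact: add_continuous.
Qed.

Lemma nbhs_translate x U : nbhs x U -> nbhs 0 [set w | U (x + w)].
Proof.
move=> xU; rewrite (_ : [set w | U (x + w)] = [set w | U (w + x)]).
  by apply: continuous_addr; rewrite add0r.
by apply/seteqP; split=> w /=; rewrite addrC.
Qed.

Lemma nbhs_untranslate x W : nbhs 0 W -> nbhs x [set y | W (y - x)].
Proof. by move=> W0; apply: continuous_addr; rewrite subrr. Qed.

Lemma nbhs0_half W : nbhs 0 W ->
  exists2 V, nbhs 0 V & forall u v, V u -> V v -> W (u + v).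
Proof.
move=> W0; have : nbhs (0 + 0 : G) W by rewrite addr0.
move=> /(@add_continuous G (0, 0))[[A B] /= [A0 B0] AB].
exists (A `&` B); first exact: filterI.
by move=> u v [Au _] [_ Bv]; exact: (AB (u, v)).
Qed.

(** For a topological group this is the only consequence of connectedness that
    the argument uses; in this form it passes to products at once. *)
Definition nbhs_generated := forall S, nbhs 0 S ->
  (forall x y, S x -> S y -> S (x + y)) -> S = setT.

Lemma connected_nbhs_generated : connected [set: G] -> nbhs_generated.
Proof.
move=> connG S S0 SD; apply: connG.
- by exists 0; exact: nbhs_singleton.
- exists S; last by rewrite setTI.
  rewrite openE => x Sx; apply: filterS (nbhs_untranslate x S0) => y /= Syx.
  by rewrite -(subrK x y); exact: SD.
- exists S; last by rewrite setTI.
  (* A point of [S] so close to [x] that their difference lies in [S]. *)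
  move=> x xS.
  have : nbhs x [set y | S (x - y)] by apply: continuous_rsub; rewrite subrr.
  by move=> /xS[y [Sy Sxy]]; rewrite -(subrK y x); exact: SD.
Qed.

End TopologicalGroups.

Lemma nbhs_generatedX (G H : topologicalZmodType) :
  nbhs_generated G -> nbhs_generated H -> nbhs_generated (prodG G H).
Proof.
move=> genG genH S [[A B] /= [A0 B0] AB] SD.
have SD2 x x' y y' : S (x, y) -> S (x', y') -> S (x + x', y + y').
  by move=> Sxy Sxy'; exact: (SD (x, y) (x', y')).
have SG : [set x | S (x, 0)] = setT.
  apply: genG => [|x x' Sx Sx'] /=; last by rewrite -(addr0 0); exact: SD2.
  by apply: filterS (A0) => x Ax; apply: AB; split=> //; exact: nbhs_singleton B0.
have SH : [set y | S (0, y)] = setT.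
  apply: genH => [|y y' Sy Sy'] /=; last by rewrite -(addr0 0); exact: SD2.
  by apply: filterS (B0) => y By; apply: AB; split=> //; exact: nbhs_singleton A0.
apply/seteqP; split=> // -[x y] _; rewrite -(addr0 x) -(add0r y); apply: SD2.
- by have : setT x by []; rewrite -SG.
- by have : setT y by []; rewrite -SH.
Qed.

(** The point [x0] is needed: the empty space is a Baire space. *)
Lemma baire_closed_cover (T : topologicalType) (x0 : T) (F : nat -> set T) :
  baire_space T -> (forall n, closed (F n)) -> (forall x, exists n, F n x) ->
  exists n (x : T), nbhs x (F n).
Proof.
move=> baireT Fcl Fcover; apply: contrapT => noint.
have : dense (\bigcap_n ~` F n).
  apply: baireT => n; split; first exact: closed_openC.
  move=> O [x Ox] oO; apply: contrapT => OF.
  apply: noint; exists n, x; rewrite nbhsE; exists O; first by split.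
  by move=> y Oy; apply: contrapT => nFy; apply: OF; exists y.
move=> /(_ setT); case; [by exists x0|exact: openT|].
by move=> x [_ nF]; have [n Fnx] := Fcover x; exact: (nF n).
Qed.

(** * Bounds on complex numbers *)

Section ComplexNumbers.
Variable R : realType.

Lemma norm_le_nat (z : R[i]) : exists N : nat, `|z| <= N%:R.
Proof.
rewrite normc_def; set r := Num.sqrt _.
exists (Num.bound r).
by rewrite -(rmorph_nat (real_complex R)) lecR ltW// archi_boundP// sqrtr_ge0.
Qed.

Lemma closed_norm_le (M : R[i]) : closed [set z : R[i]^o | `|z| <= M].
Proof.
move=> z zcl /=; apply/ler_addgt0Pr => e e0.
have [w [/= wM]] := zcl _ (nbhsx_ballx z e e0).
rewrite -ball_normE /= => zw.
rewrite -(subrK w z) (le_trans (ler_normD _ _))// addrC lerD// ltW//.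
Qed.

Lemma closed_preimage_norm_le (T : topologicalType) (g : T -> R[i]) (M : R[i]) :
  continuous (g : T -> R[i]^o) -> closed [set x | `|g x| <= M].
Proof.
by move=> /continuous_closedP /(_ [set z | `|z| <= M]); apply; exact: closed_norm_le.
Qed.

End ComplexNumbers.

(** * Degree *)

Section Degree.
Variable R : realType.

(** Peeling off the innermost difference makes the degree decrease along
    [Delta h], so that every later proof is an induction on [n]; the case
    [n = 0], the zero polynomial, is the natural base. *)
Fixpoint deg_lt (G : topologicalZmodType) n (f : G -> R[i]) : Prop :=
  if n is n'.+1 then forall h, deg_lt n' (Delta h f) else f = cst 0.

Section OneGroup.
Variable G : topologicalZmodType.
Implicit Types (f g : G -> R[i]) (x h : G).

Lemma deg_ltP n f :
  deg_lt n f <-> forall hs, size hs = n -> foldr (@Delta R G) f hs = cst 0.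
Proof.
elim: n f => [|n IHn] f /=.
  by split=> [f0 hs /size0nil->//|/(_ [::] erefl)].
split=> [degf hs|foldf h].
  case/lastP: hs => // hs h; rewrite size_rcons foldr_rcons => -[szhs].
  exact: (proj1 (IHn _) (degf h)).
by apply/IHn => hs szhs; rewrite -foldr_rcons foldf// size_rcons szhs.
Qed.

Lemma gen_polyP f : gen_poly f <->
  continuous (f : G -> R[i]^o) /\ exists n, deg_lt n.+1 f.
Proof.
split=> -[cf [n degf]]; split=> //; exists n.
  by apply/deg_ltP => hs /eqP szhs; exact: (degf (Tuple szhs)).
by move=> hs; apply: (proj1 (deg_ltP n.+1 f)) => //; rewrite size_tuple.
Qed.

Lemma Delta_cst0 h : Delta h (cst 0 : G -> R[i]) = cst 0.
Proof. by apply/funext => x; rewrite /Delta /= subrr. Qed.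

Lemma deg_lt0 n : deg_lt n (cst 0 : G -> R[i]).
Proof. by elim: n => //= n IHn h; rewrite Delta_cst0. Qed.

Lemma deg_ltW m n f : (m <= n)%N -> deg_lt m f -> deg_lt n f.
Proof.
elim: m n f => [|m IHm] [|n] f //= mn; first by move=> ->; exact: (deg_lt0 n.+1).
by move=> degf h; apply: IHm.
Qed.

Lemma deg_ltD n f g : deg_lt n f -> deg_lt n g -> deg_lt n (fun x => f x + g x).
Proof.
elim: n f g => [|n IHn] f g /=.
  by move=> -> ->; apply/funext => x; rewrite /= addr0.
move=> degf degg h.
rewrite (_ : Delta h _ = fun x => Delta h f x + Delta h g x); first exact: IHn.
by apply/funext => x; rewrite /Delta; ring.
Qed.

Lemma deg_ltB n f g : deg_lt n f -> deg_lt n g -> deg_lt n (fun x => f x - g x).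
Proof.
elim: n f g => [|n IHn] f g /=.
  by move=> -> ->; apply/funext => x; rewrite /= subr0.
move=> degf degg h.
rewrite (_ : Delta h _ = fun x => Delta h f x - Delta h g x); first exact: IHn.
by apply/funext => x; rewrite /Delta; ring.
Qed.

Lemma deg_lt_shift n f a : deg_lt n f -> deg_lt n (fun x => f (x + a)).
Proof.
elim: n f => [|n IHn] f /=; first by move=> ->.
move=> degf h.
rewrite (_ : Delta h _ = fun x => Delta h f (x + a)); first exact: IHn.
by apply/funext => x; rewrite /Delta addrAC.
Qed.

(** The cocycle identity: a property of [Delta h f] that is invariant under
    translations and sums holds for all [h] once it holds for small [h]. *)
Lemma DeltaD h k f x : Delta (h + k) f x = Delta h f (x + k) + Delta k f x.
Proof. by rewrite /Delta (addrC h k) addrA addrA subrK. Qed.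

(** Induction on the degree: for small [h] the function [Delta h g] also vanishes
    near [x0], hence everywhere, so the periods of [g] form a subgroup that
    contains a neighbourhood of [0]. *)
Lemma deg_lt_vanish n g x0 : nbhs_generated G -> deg_lt n g ->
  nbhs x0 [set x | g x = 0] -> g = cst 0.
Proof.
move=> genG; elim: n g => [|n IHn] g //= degg gx0.
have [V V0 VV] := nbhs0_half (nbhs_translate gx0).
have Dg : [set h | Delta h g = cst 0] = setT.
  apply: genG => [|h k /= gh gk]; last first.
    by apply/funext => x; rewrite DeltaD gh gk /= addr0.
  apply: filterS (V0) => h Vh /=; apply: IHn => //.
  apply: filterS (nbhs_untranslate x0 V0) => x /= Vx.
  have shift w : x0 + (x - x0 + w) = x + w by rewrite addrA (addrC x0) subrK.
  have := VV _ _ Vx Vh; have := VV _ _ Vx (nbhs_singleton V0).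
  by rewrite /= !shift addr0 /Delta => -> ->; rewrite subrr.
apply/funext => x; have : [set h | Delta h g = cst 0] (x - x0) by rewrite Dg.
move=> /(congr1 (@^~ x0)); rewrite /Delta /= (addrC x0) subrK.
by rewrite (nbhs_singleton gx0) subr0.
Qed.

(** * Bounded polynomials are continuous *)

Lemma Delta_telescope f x v k :
  \sum_(i < k) Delta v f (x + v *+ i) = f (x + v *+ k) - f x.
Proof.
elim: k => [|k IHk]; first by rewrite big_ord0 mulr0n addr0 subrr.
by rewrite big_ord_recr /= IHk /Delta mulrSr (addrA x); ring.
Qed.

Lemma Delta_bounded f x v w (M : R[i]) (V W : set G) : nbhs 0 V ->
  (forall u u', V u -> V u' -> W (u + u')) ->
  (forall u, W u -> `|f (x + u)| <= M) ->
  V v -> V w -> `|Delta v f (x + w)| <= M + M.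
Proof.
move=> V0 VV fM Vv Vw.
rewrite /Delta -addrA (le_trans (ler_normB _ _))// lerD ?fM//; first exact: VV.
by rewrite -[w]addr0; apply: VV => //; exact: nbhs_singleton.
Qed.

(** The neighbourhood [W'] depends only on [n], [M], [e] and [W]: the induction
    applies the statement to all the functions [Delta v f] at once. *)
Lemma deg_lt_equicontinuous n (M e : R[i]) (W : set G) :
  0 <= M -> 0 < e -> nbhs 0 W ->
  exists2 W', nbhs 0 W' & forall f x, deg_lt n f ->
    (forall w, W w -> `|f (x + w)| <= M) ->
    forall w, W' w -> `|f (x + w) - f x| <= e.
Proof.
elim: n M e W => [|n IHn] M e W M0 e0 W0 /=.
  exists setT; first exact: filterT.
  by move=> f x -> _ w _; rewrite /= subrr normr0 ltW.
have [V V0 VV] := nbhs0_half W0.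
have e20 : 0 < e / 2 by rewrite divr_gt0.
have [W1 W10 equi] := IHn (M + M) (e / 2) V (addr_ge0 M0 M0) e20 V0.
have [k Mk] := norm_le_nat ((M + M) / (e / 2)).
have MMk : M + M <= k.+1%:R * (e / 2).
  rewrite -ler_pdivrMr// -[leLHS]ger0_norm; last by rewrite divr_ge0 ?addr_ge0 // ltW.
  by rewrite (le_trans Mk)// ler_nat.
(* Index k + 1 is included: the progression has k + 2 points. *)
pose W' := [set v | forall i : 'I_k.+2, (W `&` W1) (v *+ i)].
exists (V `&` W').
  apply: filterI => //; apply: filter_forall => i.
  by apply: continuous_mulrn; rewrite mul0rn; exact: filterI.
move=> f x degf fM v [Vv W'v].
set g := Delta v f.
have gM w : V w -> `|g (x + w)| <= M + M := Delta_bounded V0 VV fM Vv.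
(* The k + 1 increments along the progression sum to a difference of two values
   of [f], and each of them differs from [g x] by at most [e / 2]. *)
have kgx : k.+1%:R * g x = f (x + v *+ k.+1) - f x
    - \sum_(i < k.+1) (g (x + v *+ i) - g x).
  rewrite sumrB Delta_telescope big_const_ord iter_addr_0 mulr_natl.
  by rewrite opprB addrC subrK.
rewrite -/(Delta v f x) -/g -(@ler_pM2l _ k.+1%:R) ?ltr0n//.
rewrite -[X in X * `|_|]normr_nat -normrM kgx.
rewrite (_ : k.+1%:R * e = k.+1%:R * (e / 2) + k.+1%:R * (e / 2)); last first.
  by rewrite -mulrDr -splitr.
rewrite (le_trans (ler_normB _ _))// lerD//.
  rewrite (le_trans _ MMk)// (le_trans (ler_normB _ _))// lerD//.
    by apply: fM; have [] := W'v ord_max.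
  by rewrite -[x]addr0; apply: fM; exact: nbhs_singleton.
rewrite (le_trans (ler_norm_sum _ _ _))//.
rewrite (le_trans (ler_sum _ (G := fun=> e / 2) _))//.
  move=> i _; apply: (equi _ _ (degf v) gM).
  exact: (W'v (widen_ord (leqnSn _) i)).2.
by rewrite big_const_ord iter_addr_0 mulr_natl.
Qed.

(** Boundedness gives continuity at [x0]. For small [h] the function [Delta h f]
    is bounded near [x0] as well, hence continuous by induction on the degree,
    and then it is continuous for all [h]; [Delta (y - x0) f] transports the
    continuity of [f] from [x0] to [y]. *)
Lemma deg_lt_continuous n f x0 (M : R[i]) (W : set G) : nbhs_generated G ->
  deg_lt n f -> nbhs 0 W -> (forall w, W w -> `|f (x0 + w)| <= M) ->
  continuous (f : G -> R[i]^o).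
Proof.
move=> genG; elim: n f M W => [|n IHn] f M W degf W0 fM.
  by rewrite degf; exact: cst_continuous.
have M0 : 0 <= M := le_trans (normr_ge0 _) (fM 0 (nbhs_singleton W0)).
have fx0 : {for x0, continuous (f : G -> R[i]^o)}.
  apply/cvgrPdist_le => e e0.
  have [W' W'0 equi] := deg_lt_equicontinuous n.+1 M0 e0 W0.
  apply: filterS (nbhs_untranslate x0 W'0) => x /= W'x.
  by have := equi f x0 degf fM _ W'x; rewrite (addrC x0) subrK distrC.
have [V V0 VV] := nbhs0_half W0.
have Df : [set h | continuous (Delta h f : G -> R[i]^o)] = setT.
  apply: genG => [|h k /= fh fk]; last first.
    rewrite (_ : Delta (h + k) f = fun x => Delta h f (x + k) + Delta k f x).
      move=> x; apply: cvgD; last exact: fk.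
      apply: (@continuous_comp _ _ _ (fun x => x + k) (Delta h f : G -> R[i]^o)).
        exact: continuous_addr.
      exact: fh.
    by apply/funext => x; exact: DeltaD.
  apply: filterS (V0) => h Vh /=; apply: (IHn _ (M + M) V) => // w.
  exact: (Delta_bounded V0 VV fM Vh).
move=> y; set h := y - x0.
have fh : continuous (Delta h f : G -> R[i]^o).
  by have : setT h by []; rewrite -Df.
rewrite (_ : f = fun z => f (z - h) + Delta h f (z - h)); last first.
  by apply/funext => z; rewrite /Delta subrK; ring.
have yh : y - h = x0 by rewrite /h opprB addrC subrK.
apply: (@continuous_comp _ _ _ (fun z => z - h)
  (fun x => f x + Delta h f x : R[i]^o)); first exact: continuous_addr.
by apply: cvgD; [rewrite yh|exact: fh].
Qed.

End OneGroup.

(** * Sections of a function of two variables *)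

Section TwoGroups.
Variables G H : topologicalZmodType.
Implicit Types f : G -> H -> R[i].

(** As a function of [x], an iterated difference of [f x] at [y] is a signed sum
    of finitely many sections [f^~ y']; it inherits from them continuity, and
    being a polynomial. *)
Lemma foldr_Delta_section (Q : (G -> R[i]) -> Prop) f :
  (forall u v, Q u -> Q v -> Q (fun x => u x - v x)) ->
  (forall y, Q (f^~ y)) ->
  forall hs y, Q (fun x => foldr (@Delta R H) (f x) hs y).
Proof. by move=> QB Qf; elim=> [|h hs IHhs] y //=; exact: QB. Qed.

(** The sets of points [x] with [deg_lt n (f x)] are closed and cover [G]; one of
    them is a neighbourhood of some [x0]. The iterated differences of order [n]
    of [f x] are polynomials in [x] that vanish near [x0]. *)
Lemma section_deg_bounded f : baire_space G -> nbhs_generated G ->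
  (forall y, continuous (f^~ y : G -> R[i]^o)) ->
  (forall y, exists n, deg_lt n (f^~ y)) ->
  (forall x, exists n, deg_lt n (f x)) ->
  exists n, forall x, deg_lt n (f x).
Proof.
move=> baireG genG fc fG fH.
have QB (u v : G -> R[i]) : continuous (u : G -> R[i]^o) ->
    continuous (v : G -> R[i]^o) ->
    continuous ((fun x => u x - v x) : G -> R[i]^o).
  by move=> cu cv x; apply: cvgB; [exact: cu|exact: cv].
have QD (u v : G -> R[i]) : (exists n, deg_lt n u) -> (exists n, deg_lt n v) ->
    exists n, deg_lt n (fun x => u x - v x).
  move=> [m um] [n vn]; exists (maxn m n); apply: deg_ltB.
    by apply: deg_ltW um; exact: leq_maxl.
  by apply: deg_ltW vn; exact: leq_maxr.
have [|n [x0 degx0]] := baire_closed_cover (0 : G)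
    (F := fun n => [set x | deg_lt n (f x)]) baireG _ fH.
  move=> n.
  rewrite (_ : mkset _ = \bigcap_(hs in [set hs | size hs = n]) \bigcap_y
      [set x | `|foldr (@Delta R H) (f x) hs y| <= 0]).
    apply: closed_bigI => hs _; apply: closed_bigI => y _.
    apply: closed_preimage_norm_le.
    exact: (foldr_Delta_section (Q := fun u => continuous (u : G -> R[i]^o))).
  apply/seteqP; split=> x /=.
    by move=> /deg_ltP degx hs szhs y _ /=; rewrite degx// normr0.
  move=> foldx; apply/deg_ltP => hs szhs; apply/funext => y.
  by apply/eqP; rewrite -normr_le0; exact: (foldx hs szhs y).
exists n => x; apply/deg_ltP => hs szhs; apply/funext => y.
have [m degm] := foldr_Delta_section QD fG hs y.
apply: (congr1 (@^~ x) (deg_lt_vanish (x0 := x0) genG degm _)).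
by apply: filterS degx0 => z /deg_ltP foldz; rewrite /= foldz.
Qed.

(** By induction on [m + n]: a step [(h, k)] is a step [h] in the first variable
    followed by a step [k] in the second, and each lowers one of the bounds. *)
Lemma deg_lt_prod m n (f : prodG G H -> R[i]) :
  (forall y, deg_lt m (fun x => f (x, y))) ->
  (forall x, deg_lt n (fun y => f (x, y))) -> deg_lt (m + n) f.
Proof.
elim: m n f => [|m IHm] n f fG fH.
  rewrite (_ : f = cst 0); first exact: deg_lt0.
  by apply/funext => -[x y]; exact: (congr1 (@^~ x) (fG y)).
elim: n f fG fH => [|n IHn] f fG fH.
  rewrite (_ : f = cst 0); first exact: deg_lt0.
  by apply/funext => -[x y]; exact: (congr1 (@^~ y) (fH x)).
suff degD h k : deg_lt (m + n.+1) (Delta (G := prodG G H) (h, k) f).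
  by rewrite addSn => -[h k]; exact: degD.
rewrite (_ : Delta (G := prodG G H) (h, k) f =
    fun z : prodG G H => (f (z.1 + h, z.2 + k) - f (z.1, z.2 + k))
       + (f (z.1, z.2 + k) - f (z.1, z.2))); last first.
  by apply/funext => -[x y]; rewrite /Delta /=; ring.
apply: deg_ltD.
  apply: IHm => [y|x]; first exact: (fG (y + k) h).
  exact: (deg_ltB (deg_lt_shift k (fH (x + h))) (deg_lt_shift k (fH x))).
rewrite -addSnnS; apply: IHn => [y|x]; last exact: (fH x k).
exact: (deg_ltB (fG (y + k)) (fG y)).
Qed.

End TwoGroups.

(** * Boundedness on a box *)

(** The common feature of metrizable and of locally compact groups that makes
    the category argument of [bounded_on_box] work. *)
Definition countably_bounding (H : topologicalZmodType) :=
  exists K : nat -> set H, (forall N, nbhs 0 (K N)) /\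
    forall g : H -> R[i], continuous (g : H -> R[i]^o) ->
      exists N, forall y, K N y -> `|g y| <= N%:R.

Lemma metrizable_countably_bounding (H : topologicalZmodType) :
  metrizable H R -> countably_bounding H.
Proof.
move=> [d [_ _ _ _ dnbhs]].
exists (fun N => [set y | d 0 y < N.+1%:R^-1]); split=> [N|g gc].
  by rewrite dnbhs; exists N.+1%:R^-1 => //=; rewrite invr_gt0 ltr0n.
have [M gM] := norm_le_nat (g 0).
have := gc 0; move=> /cvgrPdist_le /(_ _ ltr01).
rewrite dnbhs => -[e /= e0 eg].
(* On the ball of radius [e] the function [g] is bounded by [M + 1]. *)
exists (maxn M.+1 (Num.bound e^-1)) => y dy.
rewrite -[g y](subrK (g 0)) (le_trans (ler_normD _ _))//.
rewrite (@le_trans _ _ (1 + M%:R))//.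
  apply: lerD => //; rewrite distrC; apply: eg => /=.
  apply: (lt_trans dy); rewrite invf_plt ?posrE ?ltr0n//.
  rewrite (lt_le_trans (archi_boundP _))// ?invr_ge0 ?(ltW e0)//.
  by rewrite ler_nat leqW// leq_maxr.
by rewrite addrC natr1 ler_nat leq_maxl.
Qed.

Lemma locally_compact_countably_bounding (H : topologicalZmodType) :
  locally_compact [set: H] -> countably_bounding H.
Proof.
move=> /(_ 0 I); rewrite withinET => -[K K0 [Kco _]].
exists (fun=> K); split=> // g gc.
have gbnd y : K y -> \forall z \near y & N \near \oo, `|g z| <= N%:R.
  move=> Ky; have [M gM] := norm_le_nat (g y).
  have gy := gc y; move/cvgrPdist_le: gy => /(_ _ ltr01) gy.
  exists ([set z | `|g y - g z| <= 1], [set N | (M < N)%N]) => /=; first split=> //.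
    by exists M.+1.
  move=> [z N] /= [gz MN].
  rewrite -[g z](subrK (g y)) (le_trans (ler_normD _ _))//.
  by rewrite distrC (le_trans (lerD gz gM))// addrC natr1 ler_nat.
have [N _ KN] := proj1 (compact_near_coveringP K) Kco nat \oo
  (fun N z => `|g z| <= N%:R) _ gbnd.
by exists N => y; exact: (KN N (leqnn N)).
Qed.

(** For each [N] the points [x] such that [f x] is bounded by [N] on [K N] form a
    closed set, since the sections [f^~ y] are continuous; these sets cover [G]
    because the sections [f x] are continuous. *)
Lemma bounded_on_box (G H : topologicalZmodType) (f : G -> H -> R[i]) :
  baire_space G -> countably_bounding H ->
  (forall y, continuous (f^~ y : G -> R[i]^o)) ->
  (forall x, continuous (f x : H -> R[i]^o)) ->
  exists (M : R[i]) x0 U V, [/\ nbhs (0 : G) U, nbhs (0 : H) V &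
    forall x y, U x -> V y -> `|f (x0 + x) y| <= M].
Proof.
move=> baireG [K [K0 Kb]] fG fH.
have [|x|N [x0 x0N]] := baire_closed_cover (0 : G)
    (F := fun N => \bigcap_(y in K N) [set x | `|f x y| <= N%:R]) baireG.
- move=> N; apply: closed_bigI => y _; exact: closed_preimage_norm_le.
- by have [N fN] := Kb _ (fH x); exists N.
exists N%:R, x0; do 2! eexists; split; [exact: (nbhs_translate x0N)|exact: (K0 N)|].
by move=> x y xN Ky; exact: xN.
Qed.

Lemma sep_gen_poly_box_bounded (G H : topologicalZmodType) (f : G -> H -> R[i]) :
  baire_space G -> baire_space H ->
  countably_bounding G \/ countably_bounding H ->
  (forall y, continuous (f^~ y : G -> R[i]^o)) ->
  (forall x, continuous (f x : H -> R[i]^o)) ->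
  exists (M : R[i]) x0 y0 U V, [/\ nbhs (0 : G) U, nbhs (0 : H) V &
    forall x y, U x -> V y -> `|f (x0 + x) (y0 + y)| <= M].
Proof.
move=> baireG baireH [KG|KH] fG fH.
  have [M [y0 [V [U [V0 U0 fM]]]]] :=
    bounded_on_box (f := fun y x => f x y) baireH KG fH fG.
  by exists M, 0, y0, U, V; split=> // x y Ux Vy; rewrite add0r; exact: fM.
have [M [x0 [U [V [U0 V0 fM]]]]] := bounded_on_box baireG KH fG fH.
by exists M, x0, 0, U, V; split=> // x y Ux Vy; rewrite add0r; exact: fM.
Qed.

End Degree.

Theorem theorem6 (R : realType) (G H : topologicalZmodType)
    (connG : connected [set: G]) (connH : connected [set: H])
    (baireG : baire_space G) (baireH : baire_space H)
    (mlc : (metrizable G R \/ metrizable H R) \/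
           (locally_compact [set: G] /\ locally_compact [set: H]))
    (f : G * H -> R[i]) (fP : separately_gen_poly f) :
  gen_poly (G := prodG G H) f.
Proof.
have genG := connected_nbhs_generated connG.
have genH := connected_nbhs_generated connH.
have [fH fG] := fP.
have fHc x : continuous ((fun y => f (x, y)) : H -> R[i]^o) by have [] := fH x.
have fGc y : continuous ((fun x => f (x, y)) : G -> R[i]^o) by have [] := fG y.
have fHd x : exists n, deg_lt n (fun y => f (x, y)).
  by have /gen_polyP[_ [n]] := fH x; exists n.+1.
have fGd y : exists n, deg_lt n (fun x => f (x, y)).
  by have /gen_polyP[_ [n]] := fG y; exists n.+1.
have [n degH] := section_deg_bounded (f := fun x y => f (x, y))
  baireG genG fGc fGd fHd.
have [m degG] := section_deg_bounded (f := fun y x => f (x, y))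
  baireH genH fHc fHd fGd.
have degf : deg_lt (m + n) (f : prodG G H -> R[i]) by exact: deg_lt_prod.
apply/gen_polyP; split; last by exists (m + n)%N; exact: deg_ltW degf.
have KGH : countably_bounding R G \/ countably_bounding R H.
  case: mlc => [[KG|KH]|[_ KH]].
  - by left; exact: metrizable_countably_bounding.
  - by right; exact: metrizable_countably_bounding.
  - by right; exact: locally_compact_countably_bounding.
have [M [x0 [y0 [U [V [U0 V0 fM]]]]]] :=
  sep_gen_poly_box_bounded (f := fun x y => f (x, y)) baireG baireH KGH fGc fHc.
apply: (deg_lt_continuous (G := prodG G H) (x0 := (x0, y0)) (M := M)
  (W := U `*` V) _ degf).
- exact: nbhs_generatedX.
- by exists (U, V).
- by move=> [x y] [Ux Vy]; exact: fM.
Qed.
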